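(* Let $x_1, \ldots, x_\ell \in \mathbb{R}^d$ and $y_1, \ldots, y_m \in \mathbb{R}^d$ with $\ell, m \ge d + 1$, $P = \operatorname{co}\{x_1, \ldots, x_\ell\}$, $Q = \operatorname{co}\{y_1, \ldots, y_m\}$. Then the meta-algorithm for finding the distance between two polytopes with the steepest descent exchange rule (with subpolytope size $s = d+1$ and $q = 1$ exchanged point, as described in the context) terminates after a finite number of iterations and returns an optimal solution of the problem $$\min_{(x,y)} \|x - y\| \quad \text{subject to} \quad x \in P, \ y \in Q.$$
   Context: $\|\cdot\|$ is the Euclidean norm, $\operatorname{co}$ is convex hull, $I = \{1, \ldots, \ell\}$, $J = \{1, \ldots, m\}$. $\mathcal{A}$ is an algorithm, viewed as a single-valued map, which for any two polytopes $V, W \subset \mathbb{R}^d$ returns an optimal solution $(v_*, w_* ) = \mathcal{A}(V, W)$ of the problem $\min \|v - w\|$ subject to $v \in V$, $w \in W$. Meta-algorithm with the steepest descent exchange rule. Initialization: put $n = 0$, choose index sets $I_0 \subseteq I$, $J_0 \subseteq J$ with $|I_0| = |J_0| = d + 1$; define $P_0 = \operatorname{co}\{x_i \mid i \in I_0\}$, $Q_0 = \operatorname{co}\{y_j \mid j \in J_0\}$. Step 1: compute $(v_n, w_n) = \mathcal{A}(P_n, Q_n)$ and $\rho_{xn} = \min_{i \in I} \langle v_n - w_n, x_i - v_n \rangle$, $\rho_{yn} = \min_{j \in J} \langle w_n - v_n, y_j - w_n \rangle$. If $\rho_{xn} \ge 0$ and $\rho_{yn} \ge 0$, return $(v_n,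 w_n)$ and stop. Step 2: if $\rho_{xn} < 0$, find $i_{1n} \in I_n$ such that $v_n \in \operatorname{co}\{x_i \mid i \in I_n \setminus \{i_{1n}\}\}$ and $i_{2n} \in I$ such that $\langle v_n - w_n, x_{i_{2n}} \rangle = \min_{i \in I} \langle v_n - w_n, x_i \rangle$, and define $I_{n+1} = (I_n \setminus \{i_{1n}\}) \cup \{i_{2n}\}$, $P_{n+1} = \operatorname{co}\{x_i \mid i \in I_{n+1}\}$; otherwise set $I_{n+1} = I_n$, $P_{n+1} = P_n$. If $\rho_{yn} < 0$, find $j_{1n} \in J_n$ such that $w_n \in \operatorname{co}\{y_j \mid j \in J_n \setminus \{j_{1n}\}\}$ and $j_{2n} \in J$ such that $\langle w_n - v_n, y_{j_{2n}} \rangle = \min_{j \in J} \langle w_n - v_n, y_j \rangle$, and define $J_{n+1} = (J_n \setminus \{j_{1n}\}) \cup \{j_{2n}\}$, $Q_{n+1} = \operatorname{co}\{y_j \mid j \in J_{n+1}\}$; otherwise set $J_{n+1} = J_n$, $Q_{n+1} = Q_n$. (The required indices exist whenever they are needed.) Increase $n$ by $1$ and go to Step 1. *)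

(* Defs.v *)
From mathcomp Require Import all_boot all_order all_algebra.
From mathcomp Require Import all_classical all_reals.

Set Implicit Arguments.
Unset Strict Implicit.
Unset Printing Implicit Defensive.

Import Order.TTheory GRing.Theory Num.Theory.
Local Open Scope ring_scope.

Definition dot (R : realType) (d : nat) (u v : 'rV[R]_d) : R :=
  \sum_(k < d) u 0 k * v 0 k.

(* The norm MathComp-Analysis puts on row vectors is the sup norm, hence this
   definition. *)
Definition enorm (R : realType) (d : nat) (u : 'rV[R]_d) : R :=
  Num.sqrt (dot u u).

(* co {x_i | i \in K} *)
Definition co (R : realType) (d n : nat) (x : 'I_n -> 'rV[R]_d)
    (K : {set 'I_n}) : set 'rV[R]_d :=
  [set z | exists a : 'I_n -> R,
     [/\ forall i, i \in K -> 0 <= a i,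
         \sum_(i in K) a i = 1
       & z = \sum_(i in K) a i *: x i]]%classic.

Definition polytope (R : realType) (d : nat) (V : set 'rV[R]_d) : Prop :=
  exists (n : nat) (p : 'I_n.+1 -> 'rV[R]_d), V = co p [set: 'I_n.+1]%SET.

(* (v, w) is an optimal solution of: minimise |v - w| over v in V, w in W. *)
Definition dist_optimal (R : realType) (d : nat) (V W : set 'rV[R]_d)
    (p : 'rV[R]_d * 'rV[R]_d) : Prop :=
  [/\ V p.1, W p.2
    & forall v w, V v -> W w -> enorm (p.1 - p.2) <= enorm (v - w)].

(* A total map on sets, constrained only on polytopes; in particular its value
   depends on the polytopes and not on the points that generate them. *)
Definition distance_algorithm (R : realType) (d : nat)
    (A : set 'rV[R]_d -> set 'rV[R]_d -> 'rV[R]_d * 'rV[R]_d) : Prop :=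
  forall V W, polytope V -> polytope W -> dist_optimal V W (A V W).

(* Minimum of a nonempty finite family; [F (Ordinal n_gt0)] is a member of the
   family, so using it as initial value does not alter the minimum. *)
Definition fam_min (R : realType) (n : nat) (n_gt0 : (0 < n)%N)
    (F : 'I_n -> R) : R :=
  \big[Num.min/F (Ordinal n_gt0)]_(i < n) F i.

(* [rho] and [exchange] treat one of the two polytopes: v is the current point
   of that polytope and w the current point of the other one. *)
Definition rho (R : realType) (d n : nat) (n_gt0 : (0 < n)%N)
    (x : 'I_n -> 'rV[R]_d) (v w : 'rV[R]_d) : R :=
  fam_min n_gt0 (fun i => dot (v - w) (x i - v)).

(* A relation, since neither the removed index i1 nor, in case of ties, the
   added index i2 is determined by the current data. *)
Definition exchange (R : realType) (d n : nat) (n_gt0 : (0 < n)%N)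
    (x : 'I_n -> 'rV[R]_d) (v w : 'rV[R]_d) (K K' : {set 'I_n}) : Prop :=
  if rho n_gt0 x v w < 0 then
    exists i1 i2 : 'I_n,
      [/\ i1 \in K, co x (K :\ i1)%SET v,
          dot (v - w) (x i2) = fam_min n_gt0 (fun i => dot (v - w) (x i))
        & K' = ((K :\ i1) :|: [set i2])%SET]
  else K' = K.

(* The index sets (I_n, J_n). *)
Definition state (l m : nat) : Type := ({set 'I_l} * {set 'I_m})%type.

Definition initial (d l m : nat) (s : state l m) : Prop :=
  #|s.1| = d.+1 /\ #|s.2| = d.+1.

(* (v_n, w_n) *)
Definition current (R : realType) (d l m : nat)
    (x : 'I_l -> 'rV[R]_d) (y : 'I_m -> 'rV[R]_d)
    (A : set 'rV[R]_d -> set 'rV[R]_d -> 'rV[R]_d * 'rV[R]_d)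
    (s : state l m) : 'rV[R]_d * 'rV[R]_d :=
  A (co x s.1) (co y s.2).

Definition stops (R : realType) (d l m : nat)
    (l_gt0 : (0 < l)%N) (m_gt0 : (0 < m)%N)
    (x : 'I_l -> 'rV[R]_d) (y : 'I_m -> 'rV[R]_d)
    (A : set 'rV[R]_d -> set 'rV[R]_d -> 'rV[R]_d * 'rV[R]_d)
    (s : state l m) : Prop :=
  let: (v, w) := current x y A s in
  0 <= rho l_gt0 x v w /\ 0 <= rho m_gt0 y w v.

(* One full iteration from a state at which the method does not stop. *)
Definition step (R : realType) (d l m : nat)
    (l_gt0 : (0 < l)%N) (m_gt0 : (0 < m)%N)
    (x : 'I_l -> 'rV[R]_d) (y : 'I_m -> 'rV[R]_d)
    (A : set 'rV[R]_d -> set 'rV[R]_d -> 'rV[R]_d * 'rV[R]_d)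
    (s t : state l m) : Prop :=
  let: (v, w) := current x y A s in
  [/\ ~ stops l_gt0 m_gt0 x y A s,
      exchange l_gt0 x v w s.1 t.1
    & exchange m_gt0 y w v s.2 t.2].

(* A run of the method, with arbitrary initial index sets and arbitrary
   admissible choices of the exchanged indices.  Runs are indexed by all of
   nat; the states following the first one that satisfies [stops] are
   irrelevant. *)
Definition run (R : realType) (d l m : nat)
    (l_gt0 : (0 < l)%N) (m_gt0 : (0 < m)%N)
    (x : 'I_l -> 'rV[R]_d) (y : 'I_m -> 'rV[R]_d)
    (A : set 'rV[R]_d -> set 'rV[R]_d -> 'rV[R]_d * 'rV[R]_d)
    (s : nat -> state l m) : Prop :=
  initial d (s 0%N) /\
  forall n, ~ stops l_gt0 m_gt0 x y A (s n) ->
    step l_gt0 m_gt0 x y A (s n) (s n.+1).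

(* The method never gets stuck: after any N iterations it stops or the indices
   required for the next iteration exist. *)
Definition never_stuck (R : realType) (d l m : nat)
    (l_gt0 : (0 < l)%N) (m_gt0 : (0 < m)%N)
    (x : 'I_l -> 'rV[R]_d) (y : 'I_m -> 'rV[R]_d)
    (A : set 'rV[R]_d -> set 'rV[R]_d -> 'rV[R]_d * 'rV[R]_d) : Prop :=
  forall (s : nat -> state l m) (N : nat),
    initial d (s 0%N) ->
    (forall n, (n < N)%N -> step l_gt0 m_gt0 x y A (s n) (s n.+1)) ->
    ~ stops l_gt0 m_gt0 x y A (s N) ->
    exists t, step l_gt0 m_gt0 x y A (s N) t.

(* Main.v *)
Require Import Defs.
From mathcomp Require Import all_boot all_order all_algebra.
From mathcomp Require Import all_classical all_reals.
From mathcomp Require Import ring lra.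
Local Open Scope ring_scope.

(** At every iteration that does not stop, one of the current points, say v,
    can be moved towards the added vertex inside the new subpolytope, because
    the removed vertex was not needed to represent v; by the choice of the
    added vertex this strictly decreases the distance.  The distance is a
    function of the pair of index sets, so no pair occurs twice, and there are
    finitely many of them.  A removable vertex exists when rho < 0: the
    vertices with nonzero weight in v lie in the hyperplane through v
    orthogonal to v - w, and d + 1 points of a hyperplane are affinely
    dependent. *)

Set Implicit Arguments.
Unset Strict Implicit.
Unset Printing Implicit Defensive.

Import Order.TTheory GRing.Theory Num.Theory.

(** * The inner product and descent along a segment *)

Section Dot.
Variables (R : realType) (d : nat).
Implicit Types u v w z h : 'rV[R]_d.

Lemma dotC u v : dot u v = dot v u.
Proof. by apply: eq_bigr => k _; rewrite mulrC. Qed.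

Lemma dotDr u v w : dot u (v + w) = dot u v + dot u w.
Proof. by rewrite -big_split; apply: eq_bigr => k _; rewrite mxE mulrDr. Qed.

Lemma dotZr c u v : dot u (c *: v) = c * dot u v.
Proof. by rewrite mulr_sumr; apply: eq_bigr => k _; rewrite mxE mulrCA. Qed.

Lemma dotNr u v : dot u (- v) = - dot u v.
Proof. by rewrite -scaleN1r dotZr mulN1r. Qed.

Lemma dotDl u v w : dot (u + v) w = dot u w + dot v w.
Proof. by rewrite !(dotC _ w) dotDr. Qed.

Lemma dotNl u v : dot (- u) v = - dot u v.
Proof. by rewrite dotC dotNr dotC. Qed.

Lemma dotZl c u v : dot (c *: u) v = c * dot u v.
Proof. by rewrite dotC dotZr dotC. Qed.

Lemma dot0l u : dot 0 u = 0.
Proof. by rewrite -[X in dot X u](scale0r 0) dotZl mul0r. Qed.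

Lemma dot_sumr (I : finType) (P : pred I) u (F : I -> 'rV[R]_d) :
  dot u (\sum_(i | P i) F i) = \sum_(i | P i) dot u (F i).
Proof.
rewrite [RHS]exchange_big; apply: eq_bigr => k _.
by rewrite summxE mulr_sumr.
Qed.

Lemma dot_ge0 u : 0 <= dot u u.
Proof. by apply: sumr_ge0 => k _; rewrite -expr2 sqr_ge0. Qed.

Lemma enorm_le u v : (enorm u <= enorm v) = (dot u u <= dot v v).
Proof. by rewrite /enorm ler_sqrt // dot_ge0. Qed.

Lemma dot_distC u v : dot (u - v) (u - v) = dot (v - u) (v - u).
Proof. by rewrite -opprB dotNl dotNr opprK. Qed.

(** Along the ray from [u] in direction [h] the squared norm has slope [2 * dot u h] at 0, so a
    short step decreases it. *)
Lemma descent_direction u h : dot u h < 0 ->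
  exists t, [/\ 0 <= t, t <= 1
              & dot (u + t *: h) (u + t *: h) < dot u u].
Proof.
move=> uh0; have hh := dot_ge0 h.
have D0 : 0 < dot h h - dot u h by lra.
(* The minimiser [- dot u h / dot h h] of the quadratic may exceed 1. The larger denominator keeps
   [t] at most 1, and the squared norm changes by [t * (1 + t) * dot u h]. *)
pose t := - dot u h / (dot h h - dot u h).
have tD : t * (dot h h - dot u h) = - dot u h by rewrite divfK ?gt_eqF.
have t0 : 0 < t by rewrite divr_gt0 // oppr_gt0.
exists t; split; first exact: ltW.
  by rewrite ler_pdivrMr // mul1r; lra.
rewrite !(dotDl, dotDr, dotZl, dotZr) (dotC h u).
by nra.
Qed.

End Dot.

(** * Minima of finite families *)

Section FamMin.
Variables (R : realType) (n : nat) (n_gt0 : (0 < n)%N) (F : 'I_n -> R).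

Lemma fam_min_le i : fam_min n_gt0 F <= F i.
Proof. exact: bigmin_le_cond. Qed.

Lemma fam_min_attained : exists i, F i = fam_min n_gt0 F.
Proof.
rewrite /fam_min; apply: (big_ind (fun r => exists i, F i = r)).
- by exists (Ordinal n_gt0).
- move=> _ _ [i <-] [j <-].
  by rewrite minElt; case: ifP => _; [exists i|exists j].
- by move=> i _; exists i.
Qed.

End FamMin.

(** * Convex hulls, affine dependence and nearest points *)

Section ConvexHull.
Variables (R : realType) (d n : nat) (x : 'I_n -> 'rV[R]_d).
Implicit Types (K : {set 'I_n}) (u v w z : 'rV[R]_d).

Lemma co_vertex K i : i \in K -> co x K (x i).
Proof.
move=> iK; exists (fun j => (j == i)%:R); split=> [j _||].
- exact: ler0n.
- rewrite (bigD1 i) //= eqxx big1 ?addr0 // => j /andP[_ /negPf ->] //.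
- rewrite (bigD1 i) //= eqxx scale1r big1 ?addr0 // => j /andP[_ /negPf ->].
  by rewrite scale0r.
Qed.

Lemma co_subset K K' z : K \subset K' -> co x K z -> co x K' z.
Proof.
move=> /fintype.subsetP sKK' [a [a0 a1 ->]].
have E (V : nmodType) (F : 'I_n -> V) :
    \sum_(i in K) F i = \sum_(i in K') if i \in K then F i else 0.
  rewrite -big_mkcondr; apply: eq_bigl => i.
  by case: (boolP (i \in K)) => [/sKK' ->|]; rewrite ?andbF.
exists (fun i => if i \in K then a i else 0); split=> [i _||].
- by case: ifP => // /a0.
- by rewrite -E.
- by rewrite E; apply: eq_bigr => i _; case: ifP => // _; rewrite scale0r.
Qed.

Lemma co_segment K z z' t : co x K z -> co x K z' -> 0 <= t -> t <= 1 ->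
  co x K (z + t *: (z' - z)).
Proof.
move=> [a [a0 a1 ->]] [b [b0 b1 ->]] t0 t1.
exists (fun i => (1 - t) * a i + t * b i); split=> [i iK||].
- by rewrite addr_ge0 // mulr_ge0 ?subr_ge0 ?a0 ?b0.
- by rewrite big_split -!mulr_sumr /= a1 b1; ring.
- rewrite [RHS](eq_bigr (fun i => (1 - t) *: (a i *: x i) + t *: (b i *: x i))).
    rewrite big_split /= -!scaler_sumr scalerBl scale1r scalerBr.
    by rewrite -addrA [- _ + _]addrC.
  by move=> i _; rewrite !scalerA -scalerDl.
Qed.

Lemma co_dot_ge K u c z : (forall i, i \in K -> c <= dot u (x i)) ->
  co x K z -> c <= dot u z.
Proof.
move=> cx [a [a0 a1 ->]]; rewrite dot_sumr -[c]mul1r -a1 mulr_suml.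
by apply: ler_sum => i iK; rewrite dotZr ler_wpM2l ?a0 ?cx.
Qed.

(** Makes [distance_algorithm] applicable to subpolytopes: [polytope] asks for a family indexed by a
    whole ordinal type, which an enumeration of [K] provides. *)
Lemma polytope_co K : (0 < #|K|)%N -> polytope (co x K).
Proof.
move=> K0; have e : #|K|.-1.+1 = #|K| by rewrite prednK.
case/card_gt0P: (K0) => i0 i0K.
pose f (j : 'I_#|K|.-1.+1) := enum_val (cast_ord e j).
pose g i := cast_ord (esym e) (enum_rank_in i0K i).
have gK i : i \in K -> f (g i) = i.
  by move=> iK; rewrite /f /g cast_ordKV enum_rankK_in.
have fK j : g (f j) = j by rewrite /f /g enum_valK_in cast_ordK.
have fin j : f j \in K by exact: enum_valP.
have E (V : nmodType) (F : 'I_n -> V) :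
    \sum_(i in K) F i = \sum_(j in [set: 'I_#|K|.-1.+1]%SET) F (f j).
  rewrite (reindex_onto f g gK); apply: eq_bigl => j.
  by rewrite fin fK eqxx inE.
exists #|K|.-1, (x \o f); apply/seteqP; split=> z [a [a0 a1 ->]].
  exists (a \o f); split=> [j _||]; first exact: a0.
  - by rewrite -[RHS]a1 E.
  - by rewrite E.
exists (a \o g); split=> [i _||]; first by rewrite /= a0 ?inE.
- by rewrite E -[RHS]a1; apply: eq_bigr => j _; rewrite /= fK.
- by rewrite E; apply: eq_bigr => j _; rewrite /= fK.
Qed.

(* The square matrix with rows (1, x_i) annihilates the nonzero column (- c, u),
   so its rows are linearly dependent. *)
Lemma hyperplane_affine_dependent K u c : #|K| = d.+1 -> u != 0 ->
  (forall i, i \in K -> dot u (x i) = c) ->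
  exists b : 'I_n -> R, [/\ exists2 i, i \in K & b i != 0,
    \sum_(i in K) b i = 0 & \sum_(i in K) b i *: x i = 0].
Proof.
move=> Kd u0 uc.
have K0 : (0 < #|K|)%N by rewrite Kd.
case/card_gt0P: K0 => i0 i0K.
pose f (j : 'I_d.+1) := enum_val (cast_ord (esym Kd) j).
pose g i := cast_ord Kd (enum_rank_in i0K i).
have gK i : i \in K -> f (g i) = i.
  by move=> iK; rewrite /f /g cast_ordK enum_rankK_in.
have fK j : g (f j) = j by rewrite /f /g enum_valK_in cast_ordKV.
have fin j : f j \in K by exact: enum_valP.
have E (V : nmodType) (F : 'I_n -> V) :
    \sum_(i in K) F i = \sum_(j < d.+1) F (f j).
  by rewrite (reindex_onto f g gK); apply: eq_bigl => j; rewrite fin fK eqxx.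
pose X : 'M_(d.+1, d) := \matrix_(j < d.+1) x (f j).
pose M : 'M_(d.+1, 1 + d) := row_mx (const_mx 1) X.
have Mw : M *m col_mx (- c)%:M u^T = 0.
  rewrite mul_row_col; apply/matrixP => j k; rewrite !ord1 !mxE big_ord1 !mxE.
  rewrite eqxx mul1r mulr1n -(uc (f j) (fin j)) dotC addrC.
  by apply/eqP; rewrite subr_eq0; apply/eqP/eq_bigr => k' _; rewrite !mxE.
have nM : kermx M != 0.
  apply: contra u0; rewrite kermx_eq0 row_free_unit => uM.
  have w0 : col_mx (- c)%:M u^T = 0 by rewrite -[LHS](mulKmx uM) Mw mulmx0.
  by move/eqP: w0; rewrite col_mx_eq0 trmx_eq0 => /andP[].
have [b /sub_kermxP bM b0] := rowV0Pn nM.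
(* The first column of [b *m M = 0] says that the weights sum to zero, the others that the weighted
   sum of the points vanishes. *)
move: bM; rewrite mul_mx_row => /eqP; rewrite row_mx_eq0 => /andP[/eqP b1 /eqP bX].
exists (fun i => b 0 (g i)); split.
- have /rV0Pn[j bj] := b0.
  by exists (f j); rewrite ?fK.
- rewrite E; transitivity ((b *m const_mx 1) 0 (0 : 'I_1)); last by rewrite b1 mxE.
  by rewrite mxE; apply: eq_bigr => j _; rewrite fK mxE mulr1.
- rewrite E -[RHS]bX mulmx_sum_row; apply: eq_bigr => j _.
  by rewrite fK rowK.
Qed.

Lemma zero_weight_remove K (a : 'I_n -> R) i :
  (forall j, j \in K -> 0 <= a j) -> \sum_(j in K) a j = 1 ->
  i \in K -> a i = 0 ->
  co x (K :\ i)%SET (\sum_(j in K) a j *: x j).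
Proof.
move=> a0 a1 iK ai0; exists a; split=> [j /setD1P[_]|| ]; first exact: a0.
- rewrite -a1 (big_setD1 i iK) /= ai0 add0r //.
- by rewrite (big_setD1 i iK) /= ai0 scale0r add0r.
Qed.

(** Carathéodory reduction: subtracting a multiple of [b] from the convex weights [a] changes
    neither their sum nor the point represented. The largest multiple that leaves all weights
    nonnegative makes one of them vanish. *)
Lemma affine_dependent_remove K v (b : 'I_n -> R) :
  (exists2 i, i \in K & b i != 0) ->
  \sum_(i in K) b i = 0 -> \sum_(i in K) b i *: x i = 0 ->
  co x K v -> exists2 i, i \in K & co x (K :\ i)%SET v.
Proof.
move=> [i1 i1K bi1] b0 bx0 [a [a0 a1 ->]].
(* Weights that sum to zero and are not all zero include a positive one. *)
have [i0 /andP[i0K bi0]] : exists i, (i \in K) && (0 < b i).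
  apply/existsP; apply: contraNT bi1 => /existsPn bneg.
  have ble i : i \in K -> 0 <= - b i.
    by move=> iK; have := bneg i; rewrite iK /= -leNgt oppr_ge0.
  rewrite -oppr_eq0; apply/eqP.
  by apply: (psumr_eq0P ble _ i1K); rewrite sumrN b0 oppr0.
have P0 : [pred i | (i \in K) && (0 < b i)] i0 by rewrite /= i0K.
case: (arg_minP (fun i => a i / b i) P0) => i /andP[iK bi] imin.
exists i => //; set t := a i / b i in imin.
have t0 : 0 <= t by rewrite divr_ge0 ?a0 ?ltW.
have -> : \sum_(j in K) a j *: x j = \sum_(j in K) (a j - t * b j) *: x j.
  rewrite [RHS](eq_bigr (fun j => a j *: x j - t *: (b j *: x j))).
    by rewrite big_split sumrN /= -scaler_sumr bx0 scaler0 subr0.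
  by move=> j _; rewrite scalerBl scalerA.
apply: zero_weight_remove => // [j jK||].
- have [bj|bj] := ltP 0 (b j).
    by rewrite subr_ge0 -ler_pdivlMr // imin //= jK.
  by rewrite subr_ge0 (le_trans _ (a0 j jK)) // mulr_ge0_le0.
- by rewrite big_split sumrN /= -mulr_sumr b0 mulr0 subr0.
- by rewrite /t divfK ?subrr // gt_eqF.
Qed.

Lemma removable_vertex K u v : #|K| = d.+1 -> u != 0 -> co x K v ->
  (forall i, i \in K -> dot u v <= dot u (x i)) ->
  exists2 i, i \in K & co x (K :\ i)%SET v.
Proof.
move=> Kd u0 vK uv; have [a [a0 a1 av]] := vK.
have [/existsP[i /andP[iK /eqP ai]]|/existsPn apos] :=
    boolP [exists i, (i \in K) && (a i == 0)].
  by exists i => //; rewrite av; exact: zero_weight_remove.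
have gap0 : \sum_(i in K) a i * (dot u (x i) - dot u v) = 0.
  rewrite (eq_bigr (fun i => dot u (a i *: x i) - a i * dot u v)).
    by rewrite big_split sumrN /= -dot_sumr -av -mulr_suml a1 mul1r subrr.
  by move=> i _; rewrite dotZr mulrBr.
have uc i : i \in K -> dot u (x i) = dot u v.
  move=> iK; apply/eqP; rewrite -subr_eq0.
  have gap_ge0 j : j \in K -> 0 <= a j * (dot u (x j) - dot u v).
    by move=> jK; rewrite mulr_ge0 ?a0 ?subr_ge0 ?uv.
  have /eqP := psumr_eq0P gap_ge0 gap0 iK; rewrite mulf_eq0.
  by have := apos i; rewrite iK /= => /negPf ->.
have [b [b0 b1 bx]] := hyperplane_affine_dependent Kd u0 uc.
exact: affine_dependent_remove b0 b1 bx vK.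
Qed.

(** First-order optimality of the projection of [w]: otherwise [z - v] would be a descent direction
    and the segment from [v] to [z] would contain a closer point. *)
Lemma closest_dot_ge K v w z : co x K v ->
  (forall v', co x K v' -> dot (v - w) (v - w) <= dot (v' - w) (v' - w)) ->
  co x K z -> dot (v - w) v <= dot (v - w) z.
Proof.
move=> vK vmin zK; rewrite leNgt; apply/negP => uz.
have [|t [t0 t1]] := @descent_direction _ _ (v - w) (z - v).
  by rewrite dotDr dotNr subr_lt0.
rewrite addrAC ltNge => /negP; apply.
by apply: vmin; exact: co_segment.
Qed.

End ConvexHull.

(** * A single exchange of vertices *)

Section Exchange.
Variables (R : realType) (d n : nat) (n_gt0 : (0 < n)%N) (x : 'I_n -> 'rV[R]_d).
Implicit Types (K : {set 'I_n}) (u v w z : 'rV[R]_d).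

Lemma rho_lt0 v w : rho n_gt0 x v w < 0 ->
  exists i, dot (v - w) (x i) < dot (v - w) v.
Proof.
rewrite /rho; have [i <-] := fam_min_attained n_gt0 (fun i => dot (v - w) (x i - v)).
by rewrite dotDr dotNr subr_lt0; exists i.
Qed.

Lemma rho_ge0 v w i : 0 <= rho n_gt0 x v w -> dot (v - w) v <= dot (v - w) (x i).
Proof.
move=> /le_trans/(_ (fam_min_le n_gt0 (fun i => dot (v - w) (x i - v)) i)).
by rewrite dotDr dotNr subr_ge0.
Qed.

Lemma steepest_vertex_lt v w i : rho n_gt0 x v w < 0 ->
  dot (v - w) (x i) = fam_min n_gt0 (fun j => dot (v - w) (x j)) ->
  dot (v - w) (x i) < dot (v - w) v.
Proof.
by move=> /rho_lt0[j uj] ->; apply: le_lt_trans uj; exact: fam_min_le.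
Qed.

(** The added vertex lies strictly below the level of [v], where no vertex of [K] lies, so it is
    new. *)
Lemma exchange_card K K' v w :
  (forall i, i \in K -> dot (v - w) v <= dot (v - w) (x i)) ->
  exchange n_gt0 x v w K K' -> #|K'| = #|K|.
Proof.
rewrite /exchange => vmin; case: ifP => [rho0|_ -> //].
move=> [i1 [i2 [i1K _ /(steepest_vertex_lt rho0) ui2 ->]]].
have i2K : i2 \notin K by apply: contraTN ui2 => /vmin; rewrite leNgt.
by rewrite finset.setUC cardsU1 !inE negb_and i2K orbT [RHS](cardsD1 i1) i1K.
Qed.

Lemma exchange_exists K v w : #|K| = d.+1 -> co x K v ->
  (forall i, i \in K -> dot (v - w) v <= dot (v - w) (x i)) ->
  exists K', exchange n_gt0 x v w K K'.
Proof.
rewrite /exchange => Kd vK vmin.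
have [rho0|_] := ltP (rho n_gt0 x v w) 0; last by exists K.
(* If the two points coincided, every product in [rho] would be zero. *)
have u0 : v - w != 0.
  apply: contraTneq rho0 => u0; rewrite -leNgt.
  have [i ui] := fam_min_attained n_gt0 (fun i => dot (v - w) (x i - v)).
  by rewrite /rho -ui u0 dot0l.
have [i1 i1K vKi1] := removable_vertex Kd u0 vK vmin.
have [i2 ui2] := fam_min_attained n_gt0 (fun i => dot (v - w) (x i)).
by exists ((K :\ i1) :|: [set i2])%SET, i1, i2.
Qed.

(** Lets the current point of one polytope stay in place while the point of the other one moves. *)
Lemma exchange_keep K K' v w :
  exchange n_gt0 x v w K K' -> co x K v -> co x K' v.
Proof.
rewrite /exchange; case: ifP => [_|_ -> //].
by move=> [i1 [i2 [_ vK _ ->]]] _; apply: co_subset vK; exact: finset.subsetUl.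
Qed.

(** Both [v] and the added vertex belong to the new hull, hence so does the segment between them,
    which starts in a descent direction. *)
Lemma exchange_descent K K' v w :
  exchange n_gt0 x v w K K' -> co x K v -> rho n_gt0 x v w < 0 ->
  exists2 v', co x K' v' & dot (v' - w) (v' - w) < dot (v - w) (v - w).
Proof.
move=> ex vK rho0; have vK' := exchange_keep ex vK.
move: ex; rewrite /exchange rho0 => -[i1 [i2 [_ _ ui2 eK']]].
have [|t [t0 t1 lt_uu]] := @descent_direction _ _ (v - w) (x i2 - v).
  by rewrite dotDr dotNr subr_lt0 steepest_vertex_lt.
exists (v + t *: (x i2 - v)); last by rewrite addrAC.
by apply: co_segment => //; rewrite eK'; apply: co_vertex; rewrite !inE eqxx orbT.
Qed.

End Exchange.

(** * Monotonicity, termination and optimality of the method *)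

Section MetaAlgorithm.
Variables (R : realType) (d l m : nat) (l_gt0 : (0 < l)%N) (m_gt0 : (0 < m)%N).
Variables (x : 'I_l -> 'rV[R]_d) (y : 'I_m -> 'rV[R]_d).
Variable A : set 'rV[R]_d -> set 'rV[R]_d -> 'rV[R]_d * 'rV[R]_d.
Hypothesis hA : distance_algorithm A.
Implicit Types s t : state l m.

(** The squared distance serves as termination measure. It depends on the index sets alone because
    [A] is a map. *)
Definition gap s : R :=
  let: (v, w) := current x y A s in dot (v - w) (v - w).

Lemma current_optimal s : initial d s ->
  dist_optimal (co x s.1) (co y s.2) (current x y A s).
Proof. by move=> [s1 s2]; apply: hA; apply: polytope_co; rewrite ?s1 ?s2. Qed.

Lemma current_dot_ge s v w : initial d s -> current x y A s = (v, w) ->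
  (forall i, i \in s.1 -> dot (v - w) v <= dot (v - w) (x i)) /\
  (forall j, j \in s.2 -> dot (w - v) w <= dot (w - v) (y j)).
Proof.
move=> /current_optimal[] + + + E; rewrite E /= => vI wJ opt; split=> i iK.
  apply: (closest_dot_ge vI) (co_vertex _ iK) => v' v'I.
  by rewrite -enorm_le opt.
apply: (closest_dot_ge wJ) (co_vertex _ iK) => w' w'J.
by rewrite dot_distC [leRHS]dot_distC -enorm_le opt.
Qed.

Lemma step_initial s t :
  initial d s -> step l_gt0 m_gt0 x y A s t -> initial d t.
Proof.
move=> s0; rewrite /step; case E: (current x y A s) => [v w] [_ exI exJ].
have [vmin wmin] := current_dot_ge s0 E; case: s0 => s1 s2.
by split; [rewrite (exchange_card vmin exI)|rewrite (exchange_card wmin exJ)].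
Qed.

Lemma step_exists s : initial d s -> ~ stops l_gt0 m_gt0 x y A s ->
  exists t, step l_gt0 m_gt0 x y A s t.
Proof.
move=> s0 nstop; rewrite /step; case E: (current x y A s) => [v w].
have [vmin wmin] := current_dot_ge s0 E.
have := current_optimal s0; rewrite E => -[/= vI wJ _]; case: s0 => s1 s2.
have [I' exI] := exchange_exists l_gt0 s1 vI vmin.
have [J' exJ] := exchange_exists m_gt0 s2 wJ wmin.
by exists (I', J').
Qed.

(** Moving one point suffices: paired with the other current point, which survives its own exchange,
    it is feasible for the new subproblem and strictly better than the old pair. *)
Lemma step_gap s t :
  initial d s -> step l_gt0 m_gt0 x y A s t -> gap t < gap s.
Proof.
move=> s0 st; have t0 := step_initial s0 st.
have := current_optimal s0; have := current_optimal t0; move: st.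
rewrite /step /stops /gap.
case: (current x y A s) (current x y A t) => [v w] [v' w'] /=.
move=> [nstop exI exJ] [/= _ _ opt] [/= vI wJ _].
have vI' := exchange_keep exI vI; have wJ' := exchange_keep exJ wJ.
have {}opt z z' : co x t.1 z -> co y t.2 z' ->
    dot (v' - w') (v' - w') <= dot (z - z') (z - z').
  by move=> zI zJ; rewrite -enorm_le opt.
have [rx|rx] := ltP (rho l_gt0 x v w) 0.
  have [z zI] := exchange_descent exI vI rx.
  by apply: le_lt_trans; exact: opt.
have [ry|ry] := ltP (rho m_gt0 y w v) 0; last by case: nstop.
have [z zJ] := exchange_descent exJ wJ ry.
by rewrite dot_distC [ltRHS]dot_distC; apply: le_lt_trans; exact: opt.
Qed.

(** The two stopping inequalities extend from vertices to the hulls and add up to [dot (v - w) (v -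
    w) <= dot (v - w) (z - z')]. Expanding the square of [(z - z') - (v - w)] then gives the bound
    on the norms. *)
Lemma stops_optimal s : initial d s -> stops l_gt0 m_gt0 x y A s ->
  dist_optimal (co x [set: 'I_l]%SET) (co y [set: 'I_m]%SET)
    (current x y A s).
Proof.
move=> /current_optimal; rewrite /stops.
case: (current x y A s) => [v w] [/= vI wJ _] [rx ry]; split=> /=.
- exact: co_subset (finset.subsetT _) vI.
- exact: co_subset (finset.subsetT _) wJ.
move=> z z' zP zQ; rewrite enorm_le.
have := co_dot_ge (fun i _ => rho_ge0 i rx) zP.
have := co_dot_ge (fun j _ => rho_ge0 j ry) zQ.
have := dot_ge0 ((z - z') - (v - w)).
rewrite !(dotDl, dotDr, dotNl, dotNr).
rewrite (dotC z v) (dotC z w) (dotC z' v) (dotC z' w) (dotC w v) (dotC z' z).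
by lra.
Qed.

Lemma run_stops (s : nat -> state l m) :
  run l_gt0 m_gt0 x y A s -> exists n, stops l_gt0 m_gt0 x y A (s n).
Proof.
move=> [s0 sS]; apply: contrapT => /forallNP nstop.
have init n : initial d (s n).
  by elim: n => // n sn; exact: step_initial sn (sS n (nstop n)).
have gap_dec : {homo (gap \o s) : i j / (i < j)%N >-> i > j}.
  apply: homo_ltn => [a b c ba cb|n]; first exact: lt_trans cb ba.
  exact: step_gap (init n) (sS n (nstop n)).
(* Pigeonhole: strict decrease of [gap] would make one more state distinct than there are states. *)
have s_inj : injective (fun i : 'I_#|{: state l m}|.+1 => s i).
  move=> i j sij; apply/val_inj.
  by case: (ltngtP i j) => // /gap_dec; rewrite /= sij ltxx.
by have := leq_card _ s_inj; rewrite card_ord ltnn.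
Qed.

End MetaAlgorithm.

Theorem corollary2 (R : realType) (d l m : nat)
  (hl : (d.+1 <= l)%N) (hm : (d.+1 <= m)%N)
  (x : 'I_l -> 'rV[R]_d) (y : 'I_m -> 'rV[R]_d)
  (A : set 'rV[R]_d -> set 'rV[R]_d -> 'rV[R]_d * 'rV[R]_d)
  (hA : distance_algorithm A) :
  let l_gt0 := leq_ltn_trans (leq0n d) hl in
  let m_gt0 := leq_ltn_trans (leq0n d) hm in
  never_stuck l_gt0 m_gt0 x y A /\
  forall s : nat -> state l m, run l_gt0 m_gt0 x y A s ->
    exists N : nat,
      [/\ forall n, (n < N)%N -> ~ stops l_gt0 m_gt0 x y A (s n),
          stops l_gt0 m_gt0 x y A (s N)
        & dist_optimal (co x [set: 'I_l]%SET) (co y [set: 'I_m]%SET)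
            (current x y A (s N))].
Proof.
move=> l_gt0 m_gt0; split=> [s N s0 sS nstop|s sr].
  apply: step_exists => //.
  (* Only the first [N] iterations are known to be steps, so the induction carries the bound
     [n <= N]. *)
  have: (N <= N)%N by [].
  elim: {-2}N => // n IHn nN.
  exact: (step_initial hA (IHn (ltnW nN)) (sS n nN)).
have [n0 stop0] := run_stops hA sr; case: sr => s0 sS.
(* Passing to a boolean predicate allows the choice of the first stopping index. *)
have ex_stop : exists n, `[< stops l_gt0 m_gt0 x y A (s n) >].
  by exists n0; exact/asboolP.
case: (ex_minnP ex_stop) => N /asboolP stopN Nmin.
have nstop n : (n < N)%N -> ~ stops l_gt0 m_gt0 x y A (s n).
  by move=> nN /asboolP/Nmin; rewrite leqNgt nN.
exists N; split=> //; apply: stops_optimal stopN => //.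
have: (N <= N)%N by [].
elim: {-2}N => // n IHn nN.
exact: (step_initial hA (IHn (ltnW nN)) (sS n (nstop n nN))).
Qed.
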